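(* Let $n\ge 1$, let $\mathbf R=(R_1,\dots,R_{n-1})$ be any family of subsets of $\{1,\dots,n+1\}$, and let $p_S$ be the $T$-fixed point of the linear degeneration $\mathcal{F}l^{\mathbf R}(\mathbb C^{n+1})$ associated to an $\mathbf R$-admissible sequence $S$. Then $$\dim T_{p_S}\mathcal{F}l^{\mathbf R}(\mathbb C^{n+1})=\frac{n(n+1)}{2}+|\mathrm{Sing}(p_S)|.$$
   Context: Degenerations. Fix a basis $v_1,\dots,v_{n+1}$ of $\mathbb C^{n+1}$. For $R\subset\{1,\dots,n+1\}$ let $\pi_R:\mathbb C^{n+1}\to\mathbb C^{n+1}$ be the linear map with $\pi_R(v_k)=0$ if $k\in R$ and $\pi_R(v_k)=v_k$ otherwise. Let $M^{\mathbf R}$ be the representation $\mathbb C^{n+1}\xrightarrow{\pi_{R_1}}\cdots\xrightarrow{\pi_{R_{n-1}}}\mathbb C^{n+1}$ of the equioriented quiver of type $A_n$. $\mathcal{F}l^{\mathbf R}(\mathbb C^{n+1})$ is the closed subvariety of $\mathrm{Gr}_1(\mathbb C^{n+1})\times\cdots\times\mathrm{Gr}_n(\mathbb C^{n+1})$ of $n$-tuples $(V_1,\dots,V_n)$ with $\dim V_i=i$ defined by the conditions $\pi_{R_i}V_i\subset V_{i+1}$ for $1\le i\le n-1$; it is identified with the quiver Grassmannian $\mathrm{Gr}_{\mathbf e}(M^{\mathbf R})$ of subrepresentations of dimension vector $\mathbf e=(1,\dots,n)$. $T_{p}$ denotes its tangent space at $p$. Admissible sequences and fixed points. An $\mathbf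 R$-admissible sequence is a family $S=(S_1,\dots,S_n)$ of subsets of $\{1,\dots,n+1\}$ with $|S_i|=i$ for $1\le i\le n$ and $S_i\subset S_{i+1}\cup R_i$ for $1\le i\le n-1$. The point $p_S$ is the one with $V_i=\mathrm{span}\{v_k: k\in S_i\}$. Coefficient quiver. $Q(M^{\mathbf R})$ has vertices $v_k^i$ ($1\le k\le n+1$ the row, $1\le i\le n$ the column), and an arrow $v_k^i\to v_k^{i+1}$ for each $1\le i\le n-1$ with $k\notin R_i$. The torus $T=(\mathbb C^* )^{d_0}$, with $d_0$ the number of connected components of $Q(M^{\mathbf R})$, acts by letting the $c$-th coordinate scale all basis vectors in the $c$-th component; its fixed points are exactly the points $p_S$. $Q_S$ is the full subquiver on the vertices $v_k^i$ with $k\in S_i$. Singularity set. Put $\mathrm{pos}(i)=\{j\in\{1,\dots,n-1\}: i\in R_j\}$ for $1\le i\le n+1$. $\mathrm{Sing}_i(p_S)$ is the set of pairs $(j,h+1)$ with $j\in\{1,\dots,n+1\}$, $h\in\mathrm{pos}(i)$ and $j\notin S_{h+1}$, such that there exists $k\in\mathrm{pos}(j)$ with $k\le h$, $i\in S_t$ for all $k\le t\le h$, and the segment spanned by $v_i^k,\dots,v_i^h$ connected in $Q_S$. $\mathrm{Sing}(p_S)$ is the disjoint union $\bigsqcup_{i=1}^{n+1}\mathrm{Sing}_i(p_S)$. *)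

(* Defs.v *)
From HB Require Import structures.
From mathcomp Require Import all_boot all_order all_algebra.
From mathcomp Require Import reals complex mpoly.

Set Implicit Arguments.
Unset Strict Implicit.
Unset Printing Implicit Defensive.

Import GRing.Theory Num.Theory.
Local Open Scope ring_scope.

(* The complex numbers are [K[i]] with [K : realType], and C^{n+1} is          *)
(* ['rV[K[i]]_n.+1].  Families indexed by 1, ..., n or 1, ..., n-1 (R_i, S_i,  *)
(* V_i) are functions on [nat]: only the values at these indices are ever      *)
(* used.  Basis vectors (rows) are labelled 0, ..., n instead of 1, ..., n+1.  *)

Section Combinatorics.
Variable n : nat.
Implicit Types R S : nat -> {set 'I_n.+1}.

Definition admissible R S : Prop :=
  (forall i, (1 <= i <= n)%N -> #|S i| = i) /\
  (forall i, (1 <= i < n)%N -> S i \subset S i.+1 :|: R i).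

(* The pair (k, i) stands for v_k^i; column 0 carries no vertex of the quiver. *)
Local Notation vertex := ('I_n.+1 * 'I_n.+1)%type.

Definition arrow R : rel vertex := fun x y =>
  [&& (0 < x.2)%N, y.1 == x.1, y.2 == x.2.+1 :> nat & x.1 \notin R x.2].

Definition QS_vertices S : {set vertex} :=
  [set x : vertex | (0 < x.2)%N && (x.1 \in S x.2)].

Definition edge_in R (A : {set vertex}) : rel vertex := fun x y =>
  [&& x \in A, y \in A & arrow R x y || arrow R y x].

Definition connected_subquiver R (A : {set vertex}) : bool :=
  [forall x in A, forall y in A, connect (edge_in R A) x y].

Definition segment (i : 'I_n.+1) (k h : nat) : {set vertex} :=
  [set x : vertex | (x.1 == i) && (k <= x.2 <= h)%N].

(* As Q_S is a full subquiver, the subquiver of Q_S spanned by the segment is  *)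
(* the full subquiver of the coefficient quiver on these vertices.             *)
Definition segment_connected R S (i : 'I_n.+1) (k h : nat) : bool :=
  (segment i k h \subset QS_vertices S) && connected_subquiver R (segment i k h).

Definition pos R (i : 'I_n.+1) : {set 'I_n} :=
  [set j : 'I_n | (0 < j)%N && (i \in R j)].

(* The second component of a pair is the column number h+1 itself. *)
Definition Sing_row R S (i : 'I_n.+1) : {set 'I_n.+1 * 'I_n.+1} :=
  [set x : 'I_n.+1 * 'I_n.+1 | [exists h in pos R i,
    [&& x.2 == h.+1 :> nat, x.1 \notin S h.+1 &
      [exists k in pos R x.1,
        [&& (k <= h)%N,
            [forall t : 'I_n, (k <= t <= h)%N ==> (i \in S t)] &
            segment_connected R S i k h]]]]].

Definition Sing R S : {set 'I_n.+1 * ('I_n.+1 * 'I_n.+1)} :=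
  [set y : 'I_n.+1 * ('I_n.+1 * 'I_n.+1) | y.2 \in Sing_row R S y.1].

End Combinatorics.

Section Tangent.
Variable C : fieldType.

(* Zariski tangent space at [x0] of an affine variety [Z] in A^N: the common   *)
(* kernel of the differentials at [x0] of all polynomials vanishing on [Z].    *)
Definition zariski_tangent (N : nat) (Z : 'rV[C]_N -> Prop) (x0 u : 'rV[C]_N) :
    Prop :=
  forall f : {mpoly C[N]},
    (forall x, Z x -> f.@[fun a => x 0 a] = 0) ->
    \sum_(a < N) (f^`M(a)).@[fun b => x0 0 b] * u 0 a = 0.

Definition has_dim (N : nat) (P : 'rV[C]_N -> Prop) (d : nat) : Prop :=
  exists U : {vspace 'rV[C]_N}, (forall u, u \in U <-> P u) /\ \dim U = d.

End Tangent.

Section Degeneration.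
Variables (C : fieldType) (n : nat).
Local Notation E := 'rV[C]_n.+1.
Variable v : n.+1.-tuple E.
Implicit Types (R S A : nat -> {set 'I_n.+1}) (V : nat -> {vspace E}).

Definition proj (B : {set 'I_n.+1}) : 'End(E) :=
  linfun (fun x : E => \sum_(k | k \notin B) coord v k x *: tnth v k).

Definition Fl R V : Prop :=
  (forall i, (1 <= i <= n)%N -> \dim (V i) = i) /\
  (forall i, (1 <= i < n)%N -> (proj (R i) @: V i <= V i.+1)%VS).

Definition pt S : nat -> {vspace E} :=
  fun i => <<[seq tnth v k | k in S i]>>%VS.

(* Standard affine charts of Gr_1 x ... x Gr_n relative to the basis [v].  The *)
(* chart of a family [A] with #|A_i| = i has one coordinate x^i_{k,l} for each *)
(* 1 <= i <= n, k in A_i and l not in A_i, and sends x to the tuple of spaces  *)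
(* V_i = span { v_k + sum_(l notin A_i) x^i_{k,l} v_l : k in A_i }.            *)
(* Its image is the open set where each V_i is complementary to the span of    *)
(* the v_l with l notin A_i; these open sets cover the product.                *)
Definition chart_index A : finType :=
  {t : 'I_n.+1 * ('I_n.+1 * 'I_n.+1) |
    [&& (0 < t.1)%N, t.2.1 \in A t.1 & t.2.2 \notin A t.1]}.

Definition chart_dim A : nat := #|chart_index A|.

Definition chart_coef A (x : 'rV[C]_(chart_dim A)) (i : nat) (k l : 'I_n.+1) : C :=
  if insub (inord i, (k, l)) is Some t then x 0 (enum_rank (t : chart_index A))
  else 0.

Definition chart A (x : 'rV[C]_(chart_dim A)) : nat -> {vspace E} := fun i =>
  <<[seq (tnth v k + \sum_(l | l \notin A i) chart_coef x i k l *: tnth v l)%R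
      | k in A i]>>%VS.

(* The tangent space at [p] of a closed subvariety [X] of Gr_1 x ... x Gr_n    *)
(* (with its reduced structure) has dimension [d]: it is computed in a         *)
(* standard chart containing [p].                                              *)
Definition tangent_dim (X : (nat -> {vspace E}) -> Prop)
    (p : nat -> {vspace E}) (d : nat) : Prop :=
  exists A (x0 : 'rV[C]_(chart_dim A)),
    [/\ forall i, (1 <= i <= n)%N -> #|A i| = i,
        forall i, (1 <= i <= n)%N -> chart x0 i = p i &
        has_dim (zariski_tangent (fun x => X (chart x)) x0) d].

End Degeneration.

(* Main.v *)
Require Import Defs.
From HB Require Import structures.
From mathcomp Require Import all_boot all_order all_algebra.
From mathcomp Require Import reals complex mpoly.
Import GRing.Theory Num.Theory.
Local Open Scope ring_scope.

Set Implicit Arguments.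
Unset Strict Implicit.
Unset Printing Implicit Defensive.
(** In the chart of [S] itself, [p_S] is the origin and the points of the
    degeneration are the solutions [x] of the quadratic equations
      [l notin R_t] x^t_(k,l) = [k notin R_t] x^(t+1)_(k,l)
         + sum over p notin R_t of x^t_(k,p) x^(t+1)_(p,l)
    for [0 < t < n], [k] in [S_t], [l] outside [S_(t+1)] ([Fl_chart]).  The
    tangent space at the origin is exactly the space of solutions of their linear
    parts ([tangent_Fl_chart]).  It is contained in it because the quadratic
    polynomials vanish on the degeneration.  Conversely the linear equations do
    not mix different pairs [(k, l)], so a solution [u] is a sum of solutions
    supported on one pair each.  On such a block the quadratic terms vanish
    identically, since a nonzero term would need [k = p = l], whereas [k] is in
    [S_t] and [l] is not.  The whole line through a block thus lies in the
    degeneration, so the block is tangent, even for the reduced structure.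

    It remains to count.  There are [sum_t t (n+1-t)] coordinates and
    [sum_t t (n-t)] equations; the difference is [n(n+1)/2]
    ([card_chart_index]).  So the excess dimension is the number of
    relations between the linear equations, that is the dimension of the kernel
    of the transposed system ([dim_kernel_cokernel]).  For a fixed pair [(k, l)]
    the equations form a chain in [t], namely [x^t = x^(t+1)] with either side
    replaced by [0] when [l], respectively [k], is in [R_t].  A relation arises
    for each maximal run of equations which begins with a zero left hand side
    ([l] in [R_c]) and ends with a zero right hand side ([k] in [R_h]).  Relations
    are indexed by their last equation [h] ([cocycle_eq0], [strip_cocycle]), and
    these last equations are the elements of the singularity set ([card_Sing]). *)

(** * Zariski tangent vectors *)

Section TangentLines.

Lemma mpoly_ring_ind (R : comNzRingType) (N : nat) (P : {mpoly R[N]} -> Prop) :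
  (forall c, P c%:MP) -> (forall i, P 'X_i) ->
  (forall f g, P f -> P g -> P (f + g)) -> (forall f g, P f -> P g -> P (f * g)) ->
  forall f, P f.
Proof.
move=> Pc PX PD PM f; elim/mpolyind: f => [|c m f _ _ Pf].
  by rewrite -[0]/(@mpolyC N R 0) -?mpolyC0.
apply: PD => //; rewrite -mul_mpolyC; apply: (PM) => //.
rewrite (mpolyXE_id R m); elim/big_ind: _ => [||i _]; [by rewrite -mpolyC1|exact: PM|].
elim: (m i) => [|k IH]; first by rewrite expr0 -mpolyC1.
by rewrite exprS; exact: PM.
Qed.

Definition differential (C : fieldType) (N : nat) (x0 u : 'rV[C]_N)
    (f : {mpoly C[N]}) : C :=
  \sum_(a < N) (f^`M(a)).@[fun b => x0 0 b] * u 0 a.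

Section Differential.
Variables (C : fieldType) (N : nat) (x0 u : 'rV[C]_N).
Implicit Types f g : {mpoly C[N]}.

Lemma differentialC c : differential x0 u c%:MP = 0.
Proof. by apply: big1 => a _; rewrite mderivC meval0 mul0r. Qed.

Lemma differentialX i : differential x0 u 'X_i = u 0 i.
Proof.
rewrite /differential (bigD1 i) //= big1 => [|a ne].
  rewrite mderivX mnm1E eqxx addr0 scale1r.
  have -> : (U_(i) - U_(i))%MM = 0%MM :> 'X_{1.. N}.
    by apply/mnmP => b; rewrite mnmBE mnm0E subnn.
  by rewrite mpolyX0 meval1 mul1r.
by rewrite mderivX mnm1E eq_sym (negPf ne) scale0r meval0 mul0r.
Qed.

Lemma differentialD : {morph differential x0 u : f g / f + g}.
Proof.
move=> f g; rewrite -big_split; apply: eq_bigr => a _.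
by rewrite mderivD mevalD mulrDl.
Qed.

Lemma differentialB : {morph differential x0 u : f g / f - g}.
Proof.
move=> f g; rewrite -sumrB; apply: eq_bigr => a _.
by rewrite mderivB mevalB mulrBl.
Qed.

Lemma differentialM f g : differential x0 u (f * g) =
  differential x0 u f * g.@[fun b => x0 0 b] + f.@[fun b => x0 0 b] * differential x0 u g.
Proof.
rewrite mulr_suml mulr_sumr -big_split; apply: eq_bigr => a _ /=.
by rewrite mderivM mevalD !mevalM mulrDl mulrA mulrAC.
Qed.

(** Chain rule for the restriction of [f] to a line. *)
Lemma horner_line f :
  exists g : {poly C}, (forall s, g.[s] = f.@[fun a => (x0 + s *: u) 0 a]) /\
    g^`().[0] = differential x0 u f.
Proof.
have at0 (h : {mpoly C[N]}) (g : {poly C}) :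
    (forall s, g.[s] = h.@[fun a => (x0 + s *: u) 0 a]) ->
    g.[0] = h.@[fun a => x0 0 a].
  by move=> ->; apply: meval_eq => a; rewrite scale0r addr0.
elim/mpoly_ring_ind: f => [c|i|f1 f2 [g1 [E1 D1]] [g2 [E2 D2]]|
    f1 f2 [g1 [E1 D1]] [g2 [E2 D2]]].
- exists c%:P; split=> [s|]; first by rewrite hornerC mevalC.
  by rewrite derivC horner0 differentialC.
- exists ((x0 0 i)%:P + u 0 i *: 'X); split=> [s|].
    by rewrite !hornerE mevalXU !mxE mulrC.
  by rewrite differentialX !derivE add0r hornerZ hornerC mulr1.
- exists (g1 + g2); split=> [s|]; first by rewrite hornerD E1 E2 mevalD.
  by rewrite derivD hornerD D1 D2 differentialD.
exists (g1 * g2); split=> [s|]; first by rewrite hornerM E1 E2 mevalM.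
by rewrite derivM hornerD !hornerM D1 D2 (at0 _ _ E1) (at0 _ _ E2) differentialM.
Qed.

End Differential.

(** The field is infinite, so a polynomial that vanishes on [Z] restricts to the
    zero polynomial on a line contained in [Z]. *)
Lemma zariski_tangent_line (C : numFieldType) (N : nat) (Z : 'rV[C]_N -> Prop)
    (x0 u : 'rV[C]_N) :
  (forall s : C, Z (x0 + s *: u)) -> zariski_tangent Z x0 u.
Proof.
move=> lineZ f fZ; have [g [gE g'E]] := horner_line x0 u f.
rewrite -/(differential x0 u f) -g'E.
suff -> : g = 0 by rewrite deriv0 horner0.
apply: contraTeq isT => g_neq0.
have := max_poly_roots g_neq0 (rs := [seq i%:R | i <- iota 0 (size g)]).
rewrite size_map size_iota ltnn; apply.
  by apply/allP => s _; rewrite rootE gE fZ.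
by rewrite map_inj_uniq ?iota_uniq // => i j /eqP; rewrite eqr_nat => /eqP.
Qed.

Lemma zariski_tangent_sum (C : fieldType) (N : nat) (Z : 'rV[C]_N -> Prop)
    (x0 : 'rV[C]_N) (I : finType) (u : I -> 'rV[C]_N) :
  (forall i, zariski_tangent Z x0 (u i)) -> zariski_tangent Z x0 (\sum_i u i).
Proof.
move=> tu f fZ; under eq_bigr do rewrite summxE mulr_sumr.
by rewrite exchange_big big1 // => i _; exact: tu.
Qed.

End TangentLines.

(** * Solutions of a linear system and relations between its equations *)

Section KernelCokernel.

Lemma dim_kernel (C : fieldType) (m p : nat) (D : 'M[C]_(m, p)) :
  exists U : {vspace 'rV[C]_m},
    (forall u, u \in U <-> u *m D = 0) /\ (\dim U + \rank D)%N = m.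
Proof.
pose B := row_base (kermx D).
pose f : 'Hom('rV[C]_(\rank (kermx D)), 'rV[C]_m) := linfun (mulmxr B).
exists (limg f); split=> [u|].
  split=> [/memv_imgP[w _ ->]|uD].
    rewrite lfunE /= -mulmxA; have /sub_kermxP -> : (B <= kermx D)%MS.
      by rewrite eq_row_base.
    by rewrite mulmx0.
  have /submxP[w ->] : (u <= B)%MS by rewrite eq_row_base; apply/sub_kermxP.
  by apply/memv_imgP; exists w; rewrite ?memvf // lfunE.
rewrite limg_dim_eq.
  by rewrite dimvf /dim /= mul1n mxrank_ker subnK // rank_leq_row.
apply/eqP; rewrite -subv0; apply/subvP => w; rewrite memv_cap memvf /= memv_ker lfunE memv0.
by move/eqP/(congr1 (mulmx^~ (pinvmx B))); rewrite /= mulmxKp ?row_base_free // mul0mx => ->.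
Qed.

(** The two hypotheses say that restriction to [Q] is an isomorphism from the
    space of relations [y] between the equations [d _ i] onto the functions on
    [Q], so that there are [#|Q|] independent relations. *)
Lemma dim_kernel_cokernel (C : fieldType) (J I : finType) (Q : {set I})
    (d : J -> I -> C) :
  (forall q, q \in Q -> exists y : I -> C, (forall j, \sum_i d j i * y i = 0) /\
     forall q', q' \in Q -> y q' = (q' == q)%:R) ->
  (forall y : I -> C, (forall j, \sum_i d j i * y i = 0) ->
     (forall q, q \in Q -> y q = 0) -> forall i, y i = 0) ->
  exists U : {vspace 'rV[C]_#|J|},
    (forall u, u \in U <-> forall i, \sum_j u 0 (enum_rank j) * d j i = 0) /\
    (\dim U + #|I| = #|J| + #|Q|)%N.
Proof.
move=> dual_Q inj_Q.
pose D := \matrix_(j < #|J|, i < #|I|) d (enum_val j) (enum_val i).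
have [U [kerU dimU]] := dim_kernel D.
exists U; split=> [u|].
  rewrite kerU; split=> [uD i|uD].
    move/rowP/(_ (enum_rank i)): uD; rewrite !mxE => uD; apply: etrans _ uD.
    rewrite [RHS](reindex _ (onW_bij _ (@enum_rank_bij J))) /=.
    by apply: eq_bigr => j _; rewrite !mxE !enum_rankK.
  apply/rowP => i; rewrite !mxE; apply: etrans (uD (enum_val i)).
  rewrite (reindex _ (onW_bij _ (@enum_rank_bij J))) /=.
  by apply: eq_bigr => j _; rewrite !mxE !enum_rankK.
pose P : 'M[C]_(#|I|, #|Q|) := \matrix_(i, q) (enum_val i == enum_val q)%:R.
have cokerE (y : 'rV[C]_#|I|) : (y <= kermx D^T)%MS ->
    forall j, \sum_i d j i * y 0 (enum_rank i) = 0.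
  move/sub_kermxP/rowP => yD j; move: (yD (enum_rank j)); rewrite !mxE => yDj.
  apply: etrans _ yDj; rewrite [RHS](reindex _ (onW_bij _ (@enum_rank_bij I))) /=.
  by apply: eq_bigr => i _; rewrite !mxE !enum_rankK mulrC.
have mulP (y : 'rV[C]_#|I|) q : (y *m P) 0 q = y 0 (enum_rank (enum_val q)).
  rewrite mxE (bigD1 (enum_rank (enum_val q))) //= mxE enum_rankK eqxx mulr1.
  rewrite big1 ?addr0 // => i ne; rewrite mxE.
  by rewrite (can2_eq enum_valK enum_rankK) (negPf ne) mulr0.
have rank_coker : \rank (kermx D^T) = #|Q|.
  have capP : \rank (kermx D^T :&: kermx P)%MS = 0%N.
    apply/eqP; rewrite mxrank_eq0; apply/eqP/row_matrixP => r; rewrite row0.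
    have := row_sub r (kermx D^T :&: kermx P)%MS.
    move: (row r _) => y; rewrite sub_capmx => /andP[yD /sub_kermxP yP].
    apply/rowP => i; rewrite mxE -(enum_valK i).
    apply: (inj_Q (fun i => y 0 (enum_rank i))) => [|q qQ]; first exact: cokerE.
    by rewrite -(enum_rankK_in qQ qQ) -mulP yP mxE.
  rewrite -(mxrank_mul_ker (kermx D^T) P) capP addn0.
  apply/eqP; rewrite eqn_leq rank_leq_col /= col_leq_rank -sub1mx.
  apply/row_subP => q.
  have [y [yD yQ]] := dual_Q _ (enum_valP q).
  have /submxP[w ->]: (row q 1%:M <= (\row_i y (enum_val i)) *m P)%MS.
    suff -> : row q 1%:M = (\row_i y (enum_val i)) *m P by [].
    apply/rowP => q'; rewrite mulP !mxE enum_rankK yQ ?enum_valP //.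
    by rewrite (inj_eq enum_val_inj) eq_sym.
  apply: mulmx_sub; apply: submxMr; apply/sub_kermxP/rowP => j; rewrite !mxE.
  apply: etrans (yD (enum_val j)); rewrite (reindex _ (onW_bij _ (@enum_rank_bij I))) /=.
  by apply: eq_bigr => i _; rewrite !mxE !enum_rankK mulrC.
have := mxrank_ker D^T; rewrite rank_coker mxrank_tr => ->.
transitivity (\dim U + \rank D + (#|I| - \rank D))%N; last by rewrite dimU.
by rewrite -addnA subnKC // rank_leq_col.
Qed.

End KernelCokernel.

(** * Coordinates and equations *)

Section Counting.
Variable n : nat.
Implicit Types (k l : 'I_n.+1) (R S : nat -> {set 'I_n.+1}).
Local Notation T := ('I_n.+1 * ('I_n.+1 * 'I_n.+1))%type.

Lemma admissibleN R S l t : admissible R S ->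
  (0 < t < n)%N -> l \notin S t.+1 -> l \notin R t -> l \notin S t.
Proof.
move=> [_ sub_S] t_bd lS lR; apply/negP => /(subsetP (sub_S _ t_bd)).
by rewrite inE (negPf lS) (negPf lR).
Qed.

Lemma admissible_step R S k t : admissible R S ->
  (0 < t < n)%N -> k \in S t -> k \notin R t -> k \in S t.+1.
Proof. by move=> adm bd kS kR; apply: contraLR kS => kS; apply: (admissibleN adm). Qed.

(** The quadratic equations of the chart of [S] are indexed by the triples
    [(t, (k, l))] with [equation S k l t]. *)
Definition equation S k l (t : nat) : bool :=
  [&& 0 < t < n, k \in S t & l \notin S t.+1]%N.

Definition equations S : {set T} := [set q : T | equation S q.2.1 q.2.2 q.1].

(** Common shape of the sets of coordinates and of equations. *)
Lemma card_columns (p : pred nat) (A B : nat -> {set 'I_n.+1}) :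
  #|[pred i : T | [&& p i.1, i.2.1 \in A i.1 & i.2.2 \in B i.1]]| =
  (\sum_(t < n.+1 | p t) #|A t| * #|B t|)%N.
Proof.
rewrite -sum1_card -(@pair_big_dep _ _ _ _ _ (fun t : 'I_n.+1 => p t)
  (fun t (u : 'I_n.+1 * 'I_n.+1) => (u.1 \in A t) && (u.2 \in B t)) (fun _ _ => 1%N)).
apply: eq_bigr => t _; rewrite -cardsX -sum1_card.
by apply: eq_bigl => u; rewrite inE.
Qed.

Lemma card_chart_index R S : admissible R S ->
  #|chart_index S| = (#|equations S| + (n * (n + 1)) %/ 2)%N.
Proof.
move=> [card_S _]; have cardC t : (0 < t <= n)%N -> #|~: S t| = (n.+1 - t)%N.
  by move=> t_bd; rewrite -[LHS](addKn #|S t|) cardsC card_ord card_S.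
have -> : #|chart_index S| = (\sum_(t < n.+1 | (0 < t)%N) #|S t| * #|~: S t|)%N.
  rewrite card_sig -(card_columns (fun t => 0 < t)%N S (fun t => ~: S t)).
  by apply: eq_card => i; rewrite !inE.
have -> : #|equations S| =
    (\sum_(t < n.+1 | (0 < t < n)%N) #|S t| * #|~: S t.+1|)%N.
  rewrite cardsE -(card_columns (fun t => 0 < t < n)%N S (fun t => ~: S t.+1)).
  by apply: eq_card => i; rewrite !inE.
have -> : (\sum_(t < n.+1 | (0 < t)%N) #|S t| * #|~: S t| =
    \sum_(0 <= t < n.+1) t * (n.+1 - t))%N.
  rewrite big_mkord [RHS](bigID (fun t : 'I_n.+1 => 0 < t)%N) /= [X in (_ + X)%N]big1.
    rewrite addn0; apply: eq_bigr => t t_gt0.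
    by rewrite card_S ?cardC // t_gt0 -ltnS ltn_ord.
  by move=> t; rewrite -eqn0Ngt => /eqP ->.
have -> : (\sum_(t < n.+1 | (0 < t < n)%N) #|S t| * #|~: S t.+1| =
    \sum_(0 <= t < n.+1) t * (n - t))%N.
  rewrite big_mkord [RHS](bigID (fun t : 'I_n.+1 => 0 < t < n)%N) /= [X in (_ + X)%N]big1.
    rewrite addn0; apply: eq_bigr => t /andP[t_gt0 t_lt].
    by rewrite card_S ?cardC ?subSS ?t_gt0 ?(ltnW t_lt).
  move=> t; rewrite negb_and -eqn0Ngt -leqNgt => /orP[/eqP -> //|n_le].
  by rewrite (eqP (_ : (n - t == 0)%N)) ?muln0 // subn_eq0.
have -> : ((n * (n + 1)) %/ 2 = \sum_(0 <= t < n.+1) t)%N.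
  by rewrite bin2_sum bin2 /= addn1 mulnC divn2.
rewrite -big_split; apply: eq_big_nat => t /andP[_ t_le] /=.
by rewrite subSn // mulnS addnC.
Qed.

(** The vertices of row [k] in columns [a] to [b] all lie in [Q_S] and are
    joined by arrows; meant for [0 < a <= b]. *)
Definition run R S k (a b : nat) : bool :=
  (k \in S b) && all (fun s => (k \in S s) && (k \notin R s)) (index_iota a b).

Lemma run_nil R S k a : run R S k a a = (k \in S a).
Proof. by rewrite /run /index_iota subnn andbT. Qed.

Lemma run_recr R S k a b : (a <= b)%N ->
  run R S k a b.+1 = [&& run R S k a b, k \notin R b & k \in S b.+1].
Proof.
move=> ab; rewrite /run /index_iota subSn // -[(b - a).+1]addn1 iotaD all_cat /= subnKC // andbT.
by case: (k \in S b) (k \in S b.+1) (k \in R b) (all _ _) => [] [] [] [].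
Qed.

Lemma run_recl R S k a b : (a < b)%N ->
  run R S k a b = [&& k \in S a, k \notin R a & run R S k a.+1 b].
Proof.
move=> ab; rewrite /run /index_iota -{1}(subnSK ab) /=.
by case: (k \in S a) (k \in S b) (k \in R a) (all _ _) => [] [] [] [].
Qed.

Lemma runP R S k a b : (a <= b)%N ->
  reflect (forall s, (a <= s <= b)%N -> k \in S s /\ ((s < b)%N -> k \notin R s))
    (run R S k a b).
Proof.
move=> ab; apply: (iffP andP) => [[kb /allP ks] s /andP[as_ sb]|ks]; last first.
  split; first by case: (ks b); rewrite ?ab ?leqnn.
  apply/allP => s; rewrite mem_index_iota => /andP[as_ sb].
  by case: (ks s) => [|-> ->]; rewrite ?as_ ?(ltnW sb).
move: sb; rewrite leq_eqVlt => /orP[/eqP ->|sb]; first by rewrite ltnn.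
have /ks/andP[-> ->] // : s \in index_iota a b by rewrite mem_index_iota as_.
Qed.

(** * Relations between the linearized equations *)

(** The equations in columns at most [t] already make the left hand side
    [l notin R_t] x^t_(k,l) of equation [t] vanish: equation [c] reads
    [0 = x^(c+1)_(k,l)], and the zero propagates along the run; if [c = t] the
    left hand side has coefficient zero. *)
Definition forced R S k l (t : nat) : bool :=
  has (fun c => (l \in R c) && run R S k c t) (index_iota 1 t.+1).

(** Equation [t] has a zero right hand side and a left hand side that already
    vanishes: it is redundant. *)
Definition obstruction R S k l (t : nat) : bool :=
  [&& equation S k l t, k \in R t & forced R S k l t].

Lemma forcedP R S k l t :
  reflect (exists2 c, (0 < c <= t)%N & (l \in R c) && run R S k c t)
    (forced R S k l t).
Proof.
by apply: (iffP hasP) => -[c]; rewrite ?mem_index_iota => c1 c2; exists c;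
   rewrite ?mem_index_iota.
Qed.

Section Cokernel.
Variables (C : fieldType) (R S : nat -> {set 'I_n.+1}).
Hypothesis adm : admissible R S.
Variables k l : 'I_n.+1.

(** The weights [y t] given to the equations [t] of the pair [(k, l)] form a
    relation: the second clause says that the coefficient of each coordinate
    x^t_(k,l) in the weighted sum is zero. *)
Definition cocycle (y : nat -> C) : Prop :=
  (forall t, ~~ equation S k l t -> y t = 0) /\
  (forall t, (0 < t <= n)%N -> k \in S t -> l \notin S t ->
     (l \notin R t)%:R * y t = (k \notin R t.-1)%:R * y t.-1).

(** Walking to the left from [t], the relation transports the value [y t] until it
    meets [k] in [R] or the end of the chain, where it has to be zero; only a
    column with [l] in [R] could absorb it, and then [t] is forced. *)
Lemma cocycle_not_forced y t : cocycle y -> ~~ forced R S k l t -> y t = 0.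
Proof.
move=> [y_eq y_rec]; elim: t => [|t IH] not_forced; first by rewrite y_eq.
have [|/y_eq //] := boolP (equation S k l t.+1); case/and3P=> t_bd kS lS.
have lR : l \notin R t.+1.
  apply: contraNN not_forced => lR; apply/forcedP; exists t.+1; rewrite ?leqnn //.
  by rewrite lR run_nil.
have := y_rec t.+1; rewrite lR mul1r /= => -> //; last 2 first.
- by case/andP: t_bd => _ /ltnW.
- exact: admissibleN lR.
have [|kR] := boolP (k \in R t); first by rewrite mul0r.
rewrite mul1r; apply: IH; apply: contraNN not_forced => /forcedP[c /andP[c0 ct]].
move=> /andP[lc kc]; apply/forcedP; exists c; first by rewrite c0 leqW.
by rewrite lc run_recr // kc kR.
Qed.

(** Walking to the right transports [y t] until a column with [k] in [R] is
    reached.  There either the equation is redundant or the previous lemma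
    applies. *)
Lemma cocycle_eq0 y : cocycle y ->
  (forall t, obstruction R S k l t -> y t = 0) -> forall t, y t = 0.
Proof.
move=> cy y_obs t; have [y_eq y_rec] := cy.
have [m] := ubnP (n - t); elim: m t => // m IH t t_m.
have [eq_t|/y_eq //] := boolP (equation S k l t); have /and3P[t_bd kS lS] := eq_t.
have [kR|kR] := boolP (k \in R t).
  have [ft|] := boolP (forced R S k l t); last exact: cocycle_not_forced.
  by apply: y_obs; rewrite /obstruction eq_t kR.
have /= := y_rec t.+1; rewrite kR mul1r => <- //.
- rewrite IH ?mulr0 //; case/andP: t_bd => _ t_n.
  by rewrite -ltnS (leq_trans _ t_m) // ltnS -(subnSK t_n).
- by case/andP: t_bd.
- exact: (admissible_step adm).
Qed.

(** The columns [t] of the maximal chain of equations ending in column [h]; when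
    [h] is redundant, this chain begins at a column with [l] in [R], and its
    indicator function is the relation attached to [h]. *)
Definition strip (h t : nat) : bool :=
  [&& 0 < t <= h, run R S k t h & all (fun s => l \notin R s) (index_iota t.+1 h.+1)]%N.

Lemma strip_equation h t : equation S k l h -> strip h t -> equation S k l t.
Proof.
move=> /and3P[/andP[_ hn] kh lh] /and3P[/andP[t0 th] run_t /allP lR].
have lS s : (s <= h - t)%N -> l \notin S (h.+1 - s)%N.
  elim: s => [|s IH] s_le; first by rewrite subn0.
  have s_h : (s < h)%N by rewrite (leq_trans s_le) // leq_subr.
  have t_s : (t < h - s)%N by rewrite ltn_subRL addnC -ltn_subRL.
  rewrite subSS; apply: (admissibleN adm).
  - by rewrite (leq_trans _ t_s) //= (leq_ltn_trans _ hn) // leq_subr.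
  - by rewrite -subSn ?(ltnW s_h) // IH // ltnW.
  - by apply: lR; rewrite mem_index_iota t_s ltnS leq_subr.
rewrite /equation t0 (leq_ltn_trans th hn) /=.
have [|-> _] := runP R S k th run_t t; first by rewrite leqnn.
by have := lS _ (leqnn _); rewrite subSn ?leq_subr // subKn.
Qed.
End Cokernel.
End Counting.

Section StripCocycles.
Variables (n : nat) (C : fieldType) (R S : nat -> {set 'I_n.+1}).
Hypothesis adm : admissible R S.
Variables k l : 'I_n.+1.

Lemma strip_cocycle h : obstruction R S k l h ->
  cocycle R S k l (fun t => (strip R S k l h t)%:R : C).
Proof.
case/and3P=> eq_h kRh /forcedP[c /andP[c0 ch] /andP[lc run_c]].
split=> [t|t /andP[t0 tn] kS lS].
  apply: contraNeq; case: (boolP (strip _ _ _ _ _ _)); last by rewrite eqxx.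
  by move/(strip_equation adm eq_h) ->.
rewrite -!natrM !mulnb; congr (nat_of_bool _)%:R.
case: t t0 tn kS lS => // t _ tn kS lS /=; apply/andP/andP => -[].
  move=> lR /and3P[/andP[_ th] run_t lR_t].
  have ct : (c <= t)%N.
    rewrite leqNgt; apply/negP; rewrite leq_eqVlt => /orP[/eqP tc|tc].
      by rewrite tc lc in lR.
    by move/allP/(_ c): lR_t; rewrite mem_index_iota tc ltnS ch lc => /(_ isT).
  have [kt kRt] := runP R S k ch run_c t (introT andP (conj ct (ltnW th))).
  split; first exact: kRt.
  rewrite /strip (leq_trans c0 ct) (ltnW th) run_recl // kt kRt // run_t /=.
  by rewrite {1}/index_iota subSS -(subnSK th) /= lR; move: lR_t; rewrite /index_iota subSS.
move=> kRt /and3P[/andP[t0 th] run_t lR_t].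
have {}th : (t < h)%N.
  by rewrite ltn_neqAle th andbT; apply: contraNneq kRt => ->.
move: run_t lR_t; rewrite run_recl // {1}/index_iota subSS -(subnSK th) /=.
move=> /and3P[_ _ run_t] /andP[lR lR_t]; split=> //.
by rewrite /strip th run_t /=  /index_iota subSS.
Qed.

(** The indicator functions of the strips are dual to evaluation at the redundant
    equations: a strip meets no column with [k] in [R] before its last one. *)
Lemma strip_obstruction h h' : obstruction R S k l h ->
  obstruction R S k l h' -> strip R S k l h h' = (h' == h).
Proof.
move=> /and3P[/and3P[/andP[h0 _] kh _] _ _] /and3P[_ kRh' _].
apply/idP/eqP => [/and3P[/andP[_ hh] run_h _]|->].
  apply/eqP; move: hh; rewrite leq_eqVlt => /orP[//|hh].
  by move: run_h; rewrite run_recl // kRh' andbF.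
by rewrite /strip h0 leqnn run_nil kh /index_iota subnn.
Qed.

End StripCocycles.

(** * The singularity set *)

Section SingCard.
Variable n : nat.
Implicit Types (k l : 'I_n.+1) (R S : nat -> {set 'I_n.+1}).
Local Notation T := ('I_n.+1 * ('I_n.+1 * 'I_n.+1))%type.

Lemma edge_in_sym R (A : {set 'I_n.+1 * 'I_n.+1}) : ssrbool.symmetric (edge_in R A).
Proof. by move=> x y; rewrite /edge_in andbCA orbC. Qed.

(** If the arrow leaving column [s] of row [i] is missing, the part of the segment
    up to column [s] is a union of connected components. *)
Lemma segment_connectedE R S i (k h : nat) : (0 < k <= h)%N -> (h <= n)%N ->
  segment_connected R S i k h = run R S i k h.
Proof.
move=> /andP[k0 kh] hn; have inordE t : (t <= h)%N ->
    (inord t : 'I_n.+1) = t :> nat.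
  by move=> th; rewrite inordK // ltnS (leq_trans th).
have in_seg t : (k <= t <= h)%N -> (i, inord t) \in segment i k h.
  by case/andP=> kt th; rewrite inE eqxx /= inordE // kt.
apply/andP/(runP _ _ _ kh) => [[/subsetP sub_S con] s /andP[ks sh]|run_kh].
  have := sub_S _ (in_seg s _); rewrite ks sh => /(_ isT).
  rewrite inE /= inordE // => /andP[_ ->]; split=> // s_h; apply/negP => iR.
  have closed_le : closed (edge_in R (segment i k h)) [pred x : 'I_n.+1 * 'I_n.+1 | (x.2 <= s)%N].
    apply: intro_closed; first exact/sym_connect_sym/edge_in_sym.
    move=> x y /and3P[]; rewrite !inE => /andP[/eqP xi _] /andP[/eqP yi _].
    case/orP=> /and4P[_ _ /eqP xy]; last by rewrite xy => _ /ltnW.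
    rewrite xi xy => iRx; rewrite leq_eqVlt => /orP[/eqP xs|//].
    by rewrite xs iR in iRx.
  move/forall_inP/(_ _ (in_seg s _))/forall_inP/(_ _ (in_seg s.+1 _)): con.
  rewrite ks sh (leqW ks) s_h => /(_ isT isT) /(closed_connect closed_le).
  by rewrite !inE !inordE // leqnn ltnn.
split.
  apply/subsetP => -[j t]; rewrite !inE /= => /andP[/eqP -> t_bd].
  by case: (run_kh t t_bd) => ->; case/andP: t_bd => /(leq_trans k0) ->.
have con m : (k + m <= h)%N ->
    connect (edge_in R (segment i k h)) (i, inord k) (i, inord (k + m)).
  elim: m => [|m IH] km; first by rewrite addn0 connect0.
  rewrite addnS in km *; apply: connect_trans (IH (ltnW km)) (connect1 _).
  rewrite /edge_in !in_seg ?(leqW _) ?leq_addr ?km ?(ltnW km) //=.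
  have [_ iR] := run_kh (k + m)%N (introT andP (conj (leq_addr _ _) (ltnW km))).
  by rewrite /arrow /= !inordE ?(ltnW km) // addn_gt0 k0 !eqxx iR.
have con' x : x \in segment i k h -> connect (edge_in R (segment i k h)) (i, inord k) x.
  case: x => j t; rewrite inE /= => /andP[/eqP -> /andP[kt th]].
  by have := con (t - k)%N; rewrite subnKC // inord_val; apply.
apply/forall_inP => x /con' xk; apply/forall_inP => y /con'.
by apply: connect_trans; rewrite (sym_connect_sym (@edge_in_sym _ _)).
Qed.

Definition obstructions R S : {set T} := [set q : T | obstruction R S q.2.1 q.2.2 q.1].

(** The triple [(i, (j, h+1))] of the singularity set corresponds to the redundant
    equation of the pair [(i, j)] in column [h]. *)
Lemma card_Sing R S : #|Sing R S| = #|obstructions R S|.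
Proof.
pose g (q : T) : T := (q.2.1, (q.2.2, inord q.1.+1)).
have -> : Sing R S = g @: obstructions R S.
  apply/setP => -[i [j c]]; rewrite inE /= inE; apply/exists_inP/imsetP.
    move=> [h]; rewrite inE => /andP[h0 iR] /and3P[/eqP /= ch jS].
    move=> /exists_inP[k]; rewrite inE => /andP[k0 jR] /and3P[kh _ seg].
    have hn : (h < n)%N by [].
    exists (widen_ord (leqnSn n) h, (i, j)); last first.
      by congr (_, (_, _)); apply/val_inj; rewrite /= inordK ?ltnS.
    move: seg; rewrite segment_connectedE ?k0 ?(ltnW hn) // => run_kh.
    rewrite inE /obstruction /= /equation h0 hn jS iR /= andbT.
    have [|-> _ /=] := runP R S i kh run_kh h; first by rewrite kh leqnn.
    by apply/forcedP; exists k; rewrite ?k0 ?kh // jR.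
  case=> [[h [k l]]]; rewrite inE => /and3P[/= /and3P[/andP[h0 hn] kh lh] kR].
  move=> /forcedP[d /andP[d0 dh] /andP[lR run_d]] [-> -> ->].
  exists (Ordinal hn); first by rewrite inE /= h0.
  rewrite /= inordK ?ltnS // eqxx lh /=.
  apply/exists_inP; exists (Ordinal (leq_ltn_trans dh hn)).
    by rewrite inE d0.
  rewrite dh segment_connectedE ?d0 ?(ltnW hn) //= run_d andbT.
  by apply/forallP => t; apply/implyP => /(runP _ _ _ dh run_d)[].
apply: card_in_imset => -[h [k l]] [h' [k' l']]; rewrite !inE.
move=> /and3P[/and3P[/andP[_ hn] _ _] _ _] /and3P[/and3P[/andP[_ hn'] _ _] _ _].
case=> -> -> /(congr1 val); rewrite /= !inordK ?ltnS // => -[hh].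
by congr (_, _); apply/val_inj.
Qed.

End SingCard.

(** * Dimension of the space of solutions of the linearized equations *)

Section LinearSystem.
Variables (C : fieldType) (n : nat) (R S : nat -> {set 'I_n.+1}).
Hypothesis adm : admissible R S.
Local Notation T := ('I_n.+1 * ('I_n.+1 * 'I_n.+1))%type.

Lemma chart_coefE (x : 'rV[C]_(chart_dim S)) t (k l : 'I_n.+1) :
  chart_coef x t k l =
  \sum_(j : chart_index S) x 0 (enum_rank j) * (val j == (inord t, (k, l)))%:R.
Proof.
rewrite /chart_coef; case: insubP => [s _ <-|not_in].
  rewrite (bigD1 s) //= eqxx mulr1 big1 ?addr0 // => j ne.
  by rewrite (inj_eq val_inj) (negPf ne) mulr0.
rewrite big1 // => j _; case: eqP => [E|]; last by rewrite mulr0.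
by case/negP: not_in; rewrite -E (valP j).
Qed.

Lemma chart_coef_out (x : 'rV[C]_(chart_dim S)) t (k l : 'I_n.+1) : (t <= n)%N ->
  ~~ [&& 0 < t, k \in S t & l \notin S t]%N -> chart_coef x t k l = 0.
Proof.
move=> tn not_in; rewrite /chart_coef insubF //=.
by rewrite inordK ?ltnS //; apply/negbTE.
Qed.

Lemma chart_coef_line (u : 'rV[C]_(chart_dim S)) (s : C) t k l :
  chart_coef (0 + s *: u) t k l = s * chart_coef u t k l.
Proof. by rewrite /chart_coef add0r; case: insub => [j|]; rewrite ?mulr0 // mxE. Qed.

Definition linear_eqs (u : 'rV[C]_(chart_dim S)) : Prop :=
  forall t (k l : 'I_n.+1), equation S k l t ->
  (l \notin R t)%:R * chart_coef u t k l = (k \notin R t)%:R * chart_coef u t.+1 k l.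

(** Indexing the equations by all triples, with zero coefficients for those that
    are not equations, avoids a second subtype; the spurious zero equations are
    counted as relations in [dim_linear_eqs]. *)
Definition linear_coef (j : chart_index S) (q : T) : C :=
  (q \in equations S)%:R *
  ((q.2.2 \notin R q.1)%:R * (val j == q)%:R -
   (q.2.1 \notin R q.1)%:R * (val j == (inord q.1.+1, q.2))%:R).

Lemma linear_eqsE (u : 'rV[C]_(chart_dim S)) :
  linear_eqs u <->
  forall q, \sum_j u 0 (enum_rank j) * linear_coef j q = 0.
Proof.
have sumE q : \sum_j u 0 (enum_rank j) * linear_coef j q =
    (q \in equations S)%:R *
    ((q.2.2 \notin R q.1)%:R * chart_coef u q.1 q.2.1 q.2.2 -
     (q.2.1 \notin R q.1)%:R * chart_coef u q.1.+1 q.2.1 q.2.2).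
  rewrite !chart_coefE inord_val -!surjective_pairing !mulr_sumr -sumrB mulr_sumr.
  apply: eq_bigr => j _; rewrite /linear_coef mulrCA; congr (_ * _).
  by rewrite mulrBr !(mulrCA (u _ _)).
split=> [lin q|sum0 t k l eq_t].
  rewrite sumE; case: (boolP (q \in _)) => [|_]; last by rewrite mul0r.
  by rewrite inE => /lin ->; rewrite subrr mulr0.
have tn : (t < n.+1)%N by case/and3P: eq_t => /andP[_ /ltnW].
have := sum0 (Ordinal tn, (k, l)).
by rewrite sumE inE eq_t mul1r => /eqP; rewrite subr_eq0 => /eqP.
Qed.

Lemma sum_linear_coef (y : T -> C) (j : chart_index S) :
  (forall q, q \notin equations S -> y q = 0) ->
  \sum_q linear_coef j q * y q =
  ((val j).2.2 \notin R (val j).1)%:R * y (val j) -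
  ((val j).2.1 \notin R (val j).1.-1)%:R * y (inord (val j).1.-1, (val j).2).
Proof.
move=> y_out; have y_in q : (q \in equations S)%:R * y q = y q.
  by case: (boolP (q \in _)) => [_|/y_out ->]; rewrite ?mul1r ?mulr0.
have sum1 (F : T -> C) a : \sum_q F q * (q == a)%:R = F a.
  rewrite (bigD1 a) //= eqxx mulr1 big1 ?addr0 // => q /negPf ->.
  by rewrite mulr0.
case: j => -[t [k l]] jP; have /and3P[/= t0 kS lS] := jP.
set a : T := (inord t.-1, (k, l)).
have pred_t : (inord t.-1 : 'I_n.+1) = t.-1 :> nat.
  by rewrite inordK // prednK // ltnW.
transitivity (\sum_(q : T) ((q.2.2 \notin R q.1)%:R * y q) * (q == (t, (k, l)))%:R -
              \sum_(q : T) ((q.2.1 \notin R q.1)%:R * y q) * (q == a)%:R); last first.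
  by rewrite !sum1 /= pred_t.
rewrite -sumrB; apply: eq_bigr => q _; rewrite -(y_in q) /linear_coef /= [_ == q]eq_sym.
case: (boolP (q \in _)) => [|_]; last by rewrite !(mul0r, mulr0) subrr.
rewrite inE => /and3P[/andP[_ qn] _ _]; rewrite !mul1r.
have -> : ((t, (k, l)) == (inord q.1.+1, q.2)) = (q == a).
  apply/eqP/eqP => [[tq kl]|-> /=].
    by rewrite [q]surjective_pairing /a kl tq inordK ?ltnS //= inord_val.
  by rewrite pred_t prednK // inord_val.
by rewrite mulrBl mulrAC [X in _ - X]mulrAC.
Qed.

Lemma dim_linear_eqs : exists U : {vspace 'rV[C]_(chart_dim S)},
  (forall u, u \in U <-> linear_eqs u) /\
  \dim U = ((n * (n + 1)) %/ 2 + #|Sing R S|)%N.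
Proof.
pose Q := obstructions R S :|: ~: equations S.
have obs_eq : obstructions R S \subset equations S.
  by apply/subsetP => q; rewrite !inE => /and3P[].
have cocycleE (y : T -> C) : (forall q, q \notin equations S -> y q = 0) ->
    (forall k l, cocycle R S k l (fun t => if (t <= n)%N then y (inord t, (k, l)) else 0)) <->
    (forall j, \sum_q linear_coef j q * y q = 0).
  move=> y_out; split=> [cy j|y0 k l].
    rewrite sum_linear_coef //; case: j => -[t [k l]] /= /and3P[/= t0 kS lS].
    have tn : (t <= n)%N by rewrite -ltnS ltn_ord.
    case: (cy k l) => _ /(_ t); rewrite t0 tn (leq_trans (leq_pred _) tn) inord_val.
    by move=> -> //; rewrite subrr.
  split=> [t not_eq|t t_bd kS lS].
    case: ifP => // tn; apply: y_out.
    by rewrite inE /= inordK ?ltnS.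
  have jP : [&& 0 < (inord t : 'I_n.+1), k \in S (inord t : 'I_n.+1) &
      l \notin S (inord t : 'I_n.+1)]%N.
    by case/andP: t_bd => t0 tn; rewrite inordK ?ltnS // t0 kS lS.
  have := y0 (Sub (inord t, (k, l)) jP); rewrite sum_linear_coef //=.
  case/andP: t_bd => t0 tn; rewrite tn (leq_trans (leq_pred _) tn) inordK ?ltnS //.
  by move/eqP; rewrite subr_eq0 => /eqP.
have dual_Q q : q \in Q -> exists y : T -> C,
    (forall j, \sum_q linear_coef j q * y q = 0) /\
    forall q', q' \in Q -> y q' = (q' == q)%:R.
  rewrite in_setU; case: (boolP (q \in obstructions R S)) => [q_obs _|_ /=].
    pose y (q' : T) : C :=
      ((q'.2 == q.2) && strip R S q.2.1 q.2.2 q.1 q'.1)%:R.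
    have q_o : obstruction R S q.2.1 q.2.2 q.1 by rewrite inE in q_obs.
    have [y_eq y_rec] := strip_cocycle C adm q_o.
    have y_out q' : q' \notin equations S -> y q' = 0.
      rewrite inE /y; case: eqP => //= -> /y_eq; exact.
    exists y; split=> [|q'].
      apply/(cocycleE y y_out) => k l; rewrite /y /=.
      have [kl|ne] := eqVneq (k, l) q.2; last first.
        by split=> t *; rewrite ?if_same ?mulr0.
      rewrite -kl /= in y_eq y_rec *; split=> [t|t /andP[t0 tn] kS lS].
        by case: ifP => // tn; rewrite inordK //; apply: y_eq.
      rewrite tn (leq_trans (leq_pred _) tn) !inordK ?ltnS //; last first.
        by rewrite (leq_trans (leq_pred _) tn).
      by apply: y_rec; rewrite ?t0.
    have /and3P[eq_q _ _] := q_o.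
    rewrite in_setU in_setC => /orP[|q'_out]; last first.
      rewrite y_out //; case: eqP q'_out => // ->; by rewrite inE eq_q.
    have -> : (q' == q) = (q'.1 == q.1) && (q'.2 == q.2) by case: (q') (q) => [? ?] [? ?].
    rewrite inE /y => q'_o.
    have [E|_] := eqVneq q'.2 q.2; last by rewrite andbF.
    by rewrite E in q'_o; rewrite (strip_obstruction q_o q'_o) andbT.
  (* A zero equation is a relation by itself. *)
  rewrite in_setC => q_out; exists (fun q' => (q' == q)%:R); split=> // j.
  rewrite big1 // => q' _; case: eqP => [->|_]; last by rewrite mulr0.
  by rewrite /linear_coef (negPf q_out) !mul0r.
have inj_Q (y : T -> C) : (forall j, \sum_q linear_coef j q * y q = 0) ->
    (forall q, q \in Q -> y q = 0) -> forall q, y q = 0.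
  move=> y0 yQ.
  have y_out q : q \notin equations S -> y q = 0.
    by move=> q_out; apply: yQ; rewrite !inE in q_out *; rewrite q_out orbT.
  case=> t [k l]; have cy := (cocycleE y y_out).2 y0 k l.
  have := cocycle_eq0 adm cy; move/(_ _ t); rewrite -ltnS ltn_ord inord_val; apply.
  move=> s s_obs; case: ifP => // sn; apply: yQ.
  by rewrite !inE /= inordK ?ltnS // s_obs.
have [U [memU dimU]] := dim_kernel_cokernel dual_Q inj_Q.
exists U; split=> [u|]; first by rewrite memU linear_eqsE.
have cardQ : #|Q| = (#|obstructions R S| + #|~: equations S|)%N.
  rewrite cardsU disjoint_setI0 ?cards0 ?subn0 //.
  by rewrite disjoints_subset setCK.
apply: (@addIn #|{:T}|); apply: etrans dimU _.
rewrite cardQ (card_chart_index adm) card_Sing -(cardsC (equations S)).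
by rewrite (addnC #|_|) addnACA.
Qed.

End LinearSystem.

(** * The degeneration in the chart of S *)

Section Charts.
Variables (C : fieldType) (n : nat) (v : n.+1.-tuple 'rV[C]_n.+1).
Hypothesis hv : basis_of fullv v.
Variables (R S : nat -> {set 'I_n.+1}).
Hypothesis adm : admissible R S.
Implicit Types (x u : 'rV[C]_(chart_dim S)) (k l p : 'I_n.+1).

Lemma coord_tnth p k : coord v p (tnth v k) = (k == p)%:R.
Proof. by rewrite (tnth_nth 0) coord_free ?(basis_free hv) // eq_sym. Qed.

Lemma coordP (y z : 'rV[C]_n.+1) : (forall p, coord v p y = coord v p z) -> y = z.
Proof.
move=> yz; rewrite (coord_basis hv (memvf y)) (coord_basis hv (memvf z)).
by apply: eq_bigr => p _; rewrite yz.
Qed.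

Definition chart_vector x (t : nat) k : 'rV[C]_n.+1 :=
  tnth v k + \sum_(l | l \notin S t) chart_coef x t k l *: tnth v l.

Lemma chartE x t : chart v x t = <<[seq chart_vector x t k | k in S t]>>%VS.
Proof. by []. Qed.

Lemma coord_sum (P : pred 'I_n.+1) (a : 'I_n.+1 -> C) p :
  coord v p (\sum_(l | P l) a l *: tnth v l) = (P p)%:R * a p.
Proof.
rewrite linear_sum /=; under eq_bigr do rewrite linearZ /= coord_tnth.
rewrite big_mkcond (bigD1 p) //= eqxx mulr1 big1 ?addr0.
  by case: (P p); rewrite ?mul1r ?mul0r.
by move=> l /negPf ->; rewrite mulr0 if_same.
Qed.

Lemma coord_chart_vector x t k p : (t <= n)%N ->
  coord v p (chart_vector x t k) = (k == p)%:R + chart_coef x t k p.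
Proof.
move=> tn; rewrite linearD /= coord_tnth coord_sum; congr (_ + _).
have [pS|_] := boolP (p \in S t); last by rewrite mul1r.
by rewrite mul0r chart_coef_out // pS !andbF.
Qed.

Lemma coord_proj (B : {set 'I_n.+1}) p y :
  coord v p (proj v B y) = (p \notin B)%:R * coord v p y.
Proof.
pose f (z : 'rV[C]_n.+1) := \sum_(k | k \notin B) coord v k z *: tnth v k.
have f_lin : linear f.
  move=> a z z'; rewrite /f scaler_sumr -big_split; apply: eq_bigr => k _ /=.
  by rewrite linearP /= scalerDl scalerA.
pose F : {linear 'rV[C]_n.+1 -> 'rV[C]_n.+1} := HB.pack f (GRing.isLinear.Build _ _ _ _ f f_lin).
by rewrite /proj -/f (lfunE F) /= coord_sum.
Qed.

Lemma memv_span_image (w : 'I_n.+1 -> 'rV[C]_n.+1) (A : {set 'I_n.+1}) y :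
  y \in <<[seq w k | k in A]>>%VS <-> exists a : 'I_n.+1 -> C, y = \sum_(k in A) a k *: w k.
Proof.
rewrite span_def big_image; split=> [/memv_sumP[z zw ->]|[a ->]].
  have aP k : exists a, (k \in A) ==> (z k == a *: w k).
    have [/zw /vlineP[a ->]|_] := boolP (k \in A); last by exists 0.
    by exists a; rewrite eqxx.
  pose a k := xchoose (aP k); exists a; apply: eq_bigr => k kA.
  exact/eqP/(implyP (xchooseP (aP k))).
by apply/memv_sumP; exists (fun k => a k *: w k) => // k _; rewrite memvZ // memv_line.
Qed.

(** [chart v x t] is the graph of the linear map with matrix [x^t] from the span of
    the [v_k], [k] in [S_t], to the span of the remaining [v_l]. *)
Lemma mem_chart x t y : (t <= n)%N -> (0 < t)%N ->
  y \in chart v x t <->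
  forall l, l \notin S t ->
    coord v l y = \sum_(k in S t) coord v k y * chart_coef x t k l.
Proof.
move=> tn t0; rewrite chartE memv_span_image.
have coordE (a : 'I_n.+1 -> C) p : coord v p (\sum_(k in S t) a k *: chart_vector x t k) =
    (p \in S t)%:R * a p + \sum_(k in S t) a k * chart_coef x t k p.
  rewrite linear_sum /=; under eq_bigr do rewrite linearZ /= coord_chart_vector // mulrDr.
  rewrite big_split /=; congr (_ + _); rewrite big_mkcond (bigD1 p) //= eqxx mulr1 big1 ?addr0.
    by case: (p \in S t); rewrite ?mul1r ?mul0r.
  by move=> l /negPf ->; rewrite mulr0 if_same.
have coord_in (a : 'I_n.+1 -> C) p : p \in S t ->
    coord v p (\sum_(k in S t) a k *: chart_vector x t k) = a p.
  move=> pS; rewrite coordE pS mul1r big1 ?addr0 // => k _.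
  by rewrite chart_coef_out ?mulr0 // pS !andbF.
split=> [[a ->] l lS|yE].
  rewrite coordE (negPf lS) mul0r add0r; apply: eq_bigr => k kS.
  by rewrite coord_in.
exists (fun k => coord v k y); apply: coordP => p.
have [pS|pS] := boolP (p \in S t); first by rewrite coord_in.
by rewrite coordE (negPf pS) mul0r add0r yE.
Qed.

(** The spanning vectors are free because their coordinates in [S_t] are those of
    the [v_k]. *)
Lemma dim_chart x t : (0 < t <= n)%N -> \dim (chart v x t) = t.
Proof.
move=> /andP[t0 tn]; rewrite chartE -[RHS](adm.1 t) ?t0 //.
suff /eqP -> : free [seq chart_vector x t k | k in S t] by rewrite size_image.
have -> : [seq chart_vector x t k | k in S t] =
    [tuple chart_vector x t (enum_val i) | i < #|S t|].
  apply: (@eq_from_nth _ 0) => [|i]; first by rewrite !size_tuple.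
  rewrite size_image => i_lt.
  rewrite -[RHS](tnth_nth 0 _ (Ordinal i_lt)) tnth_mktuple.
  exact: (nth_image 0 _ (Ordinal i_lt)).
apply/freeP => a; under eq_bigr do rewrite -tnth_nth tnth_mktuple.
move=> a0 i.
have := congr1 (coord v (enum_val i)) a0; rewrite linear0 linear_sum /= => <-.
rewrite (bigD1 i) //= big1 ?addr0 => [|j ji]; rewrite linearZ /=;
  rewrite coord_chart_vector // (chart_coef_out _ tn) ?enum_valP ?andbF // addr0.
  by rewrite eqxx mulr1.
by rewrite (inj_eq enum_val_inj) (negPf ji) mulr0.
Qed.

Lemma chart0 t : chart v (0 : 'rV[C]_(chart_dim S)) t = pt v S t.
Proof.
rewrite chartE /pt; congr <<_>>%VS; apply: eq_image => // k.
rewrite /chart_vector big1 ?addr0 // => l _.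
by rewrite /chart_coef; case: insub => [j|]; rewrite ?mxE scale0r.
Qed.

Definition chart_eqs x : Prop :=
  forall t k l, equation S k l t ->
  (l \notin R t)%:R * chart_coef x t k l =
  (k \notin R t)%:R * chart_coef x t.+1 k l +
  \sum_(p | p \notin R t) chart_coef x t k p * chart_coef x t.+1 p l.

(** Apply the graph equations of [V_(t+1)] to the image of the vector spanned by
    [k] in [V_t].  Its constant term at [p = k] gives the linear right hand side;
    on the left the constant term at [l = k] is excluded by admissibility. *)
Lemma Fl_chart x : Fl v R (chart v x) <-> chart_eqs x.
Proof.
pose in_next t k := proj v (R t) (chart_vector x t k) \in chart v x t.+1.
have FlE : Fl v R (chart v x) <-> forall t, (0 < t < n)%N -> forall k, k \in S t -> in_next t k.
  split=> [[_ sub] t t_bd k kS|sub].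
    apply: (subvP (sub t t_bd)); apply: memv_img; rewrite chartE memv_span //.
    exact: image_f.
  split=> [t t_bd|t t_bd]; first exact: dim_chart.
  rewrite chartE limg_span; apply/span_subvP => _ /mapP[_ /imageP[k kS ->] ->].
  exact: sub.
have nextE t k : (0 < t < n)%N -> k \in S t ->
    in_next t k <-> forall l, l \notin S t.+1 ->
    (l \notin R t)%:R * chart_coef x t k l =
    (k \notin R t)%:R * chart_coef x t.+1 k l +
    \sum_(p | p \notin R t) chart_coef x t k p * chart_coef x t.+1 p l.
  move=> t_bd kS; have /andP[t0 tn] := t_bd; rewrite /in_next mem_chart //.
  have lhsE l : l \notin S t.+1 -> coord v l (proj v (R t) (chart_vector x t k)) =
      (l \notin R t)%:R * chart_coef x t k l.
    move=> lS; rewrite coord_proj coord_chart_vector ?(ltnW tn) // mulrDr.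
    have [lR|] := boolP (l \notin R t); last by rewrite !mul0r addr0.
    have := admissibleN adm t_bd lS lR; case: (eqVneq k l) kS => [-> ->|] //.
    by rewrite mulr0 add0r.
  have rhsE l : l \notin S t.+1 ->
      \sum_(p in S t.+1) coord v p (proj v (R t) (chart_vector x t k)) * chart_coef x t.+1 p l =
      (k \notin R t)%:R * chart_coef x t.+1 k l +
      \sum_(p | p \notin R t) chart_coef x t k p * chart_coef x t.+1 p l.
    move=> lS; rewrite big_mkcond [X in _ = _ + X]big_mkcond /=.
    transitivity (\sum_p ((k == p)%:R * ((p \notin R t)%:R * chart_coef x t.+1 p l) +
        (p \notin R t)%:R * (chart_coef x t k p * chart_coef x t.+1 p l))).
      apply: eq_bigr => p _; rewrite coord_proj coord_chart_vector ?(ltnW tn) //.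
      case: ifPn => [_|pS]; first by rewrite -mulrA mulrDl mulrDr mulrCA.
      by rewrite (@chart_coef_out _ _ _ _ _ p) // ?(negPf pS) ?andbF // !mulr0 addr0.
    rewrite big_split /=; congr (_ + _).
      rewrite (bigD1 k) //= eqxx mul1r big1 ?addr0 // => p /negPf.
      by rewrite eq_sym => ->; rewrite mul0r.
    by apply: eq_bigr => p _; case: (p \in R t); rewrite ?mul0r ?mul1r.
  by split=> E l lS; [rewrite -lhsE // -rhsE // E|rewrite lhsE // rhsE // E].
rewrite FlE; split=> [E t k l /and3P[t_bd kS lS]|E t t_bd k kS].
  by move/nextE: (E t t_bd k kS); apply.
by apply/nextE => // l lS; apply: E; rewrite /equation t_bd kS lS.
Qed.

End Charts.

(** * The tangent space *)

Section TangentSpace.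
Variables (C : numFieldType) (n : nat) (v : n.+1.-tuple 'rV[C]_n.+1).
Hypothesis hv : basis_of fullv v.
Variables (R S : nat -> {set 'I_n.+1}).
Hypothesis adm : admissible R S.
Implicit Types (x u : 'rV[C]_(chart_dim S)) (k l p : 'I_n.+1).

Definition block u (kl : 'I_n.+1 * 'I_n.+1) : 'rV[C]_(chart_dim S) :=
  \row_a if (val (enum_val a)).2 == kl then u 0 a else 0.

Lemma sum_block u : u = \sum_kl block u kl.
Proof.
apply/rowP => a; rewrite summxE (bigD1 (val (enum_val a)).2) //= mxE eqxx.
by rewrite big1 ?addr0 // => kl /negPf; rewrite mxE eq_sym => ->.
Qed.

Lemma chart_coef_block u kl t k l :
  chart_coef (block u kl) t k l = if (k, l) == kl then chart_coef u t k l else 0.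
Proof.
rewrite /chart_coef; case: insubP => [j _ j_eq|_]; last by rewrite if_same.
by rewrite mxE enum_rankK j_eq.
Qed.

(** Each quadratic term of a block vanishes: it would need [(k, p) = (p, l)], hence
    [k = l], for which the chart has no coordinate. *)
Lemma block_line u kl (s : C) : linear_eqs R u -> chart_eqs R (0 + s *: block u kl).
Proof.
move=> lin t k l eq_t; have /and3P[/andP[t0 tn] kS lS] := eq_t.
rewrite big1 => [|p _]; rewrite !chart_coef_line !chart_coef_block; last first.
  have [kp|] := eqVneq (k, p) kl; last by rewrite mulr0 mul0r.
  have [pl|] := eqVneq (p, l) kl; last by rewrite !mulr0.
  have [/= -> _] : (k, p) = (p, l) by rewrite kp pl.
  by rewrite chart_coef_out ?mulr0 ?mul0r ?(ltnW tn) // andbN andbF.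
rewrite addr0; case: eqP => _; last by rewrite !mulr0.
by rewrite mulrCA lin // mulrCA.
Qed.

Definition coef_poly t k l : {mpoly C[chart_dim S]} :=
  if insub (inord t, (k, l)) is Some j then 'X_(enum_rank (j : chart_index S)) else 0.

Lemma meval_coef_poly x t k l :
  (coef_poly t k l).@[fun a => x 0 a] = chart_coef x t k l.
Proof.
by rewrite /coef_poly /chart_coef; case: insub => [j|]; rewrite ?mevalXU ?meval0.
Qed.

Lemma differential_coef_poly x u t k l :
  differential x u (coef_poly t k l) = chart_coef u t k l.
Proof.
rewrite /coef_poly /chart_coef; case: insub => [j|]; first exact: differentialX.
by rewrite -mpolyC0 differentialC.
Qed.

Lemma tangent_Fl_chart u :
  zariski_tangent (fun x => Fl v R (chart v x)) 0 u <-> linear_eqs R u.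
Proof.
split=> [tan t k l eq_t|lin]; last first.
  rewrite [u]sum_block; apply: zariski_tangent_sum => kl.
  by apply: zariski_tangent_line => s; apply/(Fl_chart hv adm); apply: block_line.
pose f : {mpoly C[chart_dim S]} := ((l \notin R t)%:R)%:MP * coef_poly t k l -
  (((k \notin R t)%:R)%:MP * coef_poly t.+1 k l +
   \sum_(p | p \notin R t) coef_poly t k p * coef_poly t.+1 p l).
have coef0 t' k' l' : chart_coef (0 : 'rV[C]_(chart_dim S)) t' k' l' = 0.
  by rewrite /chart_coef; case: insub => // j; rewrite mxE.
have /tan : forall x, Fl v R (chart v x) -> f.@[fun a => x 0 a] = 0.
  move=> x /(Fl_chart hv adm) Ex; rewrite mevalB mevalD !mevalM !mevalC !meval_coef_poly.
  rewrite Ex // raddf_sum /=; apply/eqP; rewrite subr_eq0; apply/eqP; congr (_ + _).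
  by apply: eq_bigr => p _; rewrite mevalM !meval_coef_poly.
rewrite -/(differential 0 u f) differentialB differentialD !differentialM !differentialC.
rewrite !mevalC !differential_coef_poly !mul0r !add0r.
rewrite (big_morph _ (differentialD 0 u) (_ : _ = 0)) ?big1 ?addr0; first last.
- by rewrite -mpolyC0 differentialC.
- by move=> p _; rewrite differentialM !meval_coef_poly !coef0 mulr0 mul0r addr0.
by move/eqP; rewrite subr_eq0 => /eqP.
Qed.

End TangentSpace.

Theorem mainTheorem2 (K : realType) (n : nat) (hn : (1 <= n)%N)
    (v : n.+1.-tuple 'rV[K[i]]_n.+1) (hv : basis_of fullv v)
    (R S : nat -> {set 'I_n.+1}) (hS : admissible R S) :
  tangent_dim v (Fl v R) (pt v S) ((n * (n + 1)) %/ 2 + #|Sing R S|)%N.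
Proof.
exists S, 0; split=> [|i _|]; first exact: hS.1.
  exact: chart0.
have [U [memU dimU]] := dim_linear_eqs K[i] hS.
by exists U; split=> // u; rewrite memU (tangent_Fl_chart hv hS).
Qed.
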